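(* Let $\pi$ be chosen uniformly at random from $\mathrm{PF}(m,n)$. (i) Fix $0<c<1$ and a positive integer $\ell$; as $n\to\infty$ with $m=cn$ an integer, $$\mathbb E(\pi_1^\ell)=\frac{n^\ell}{\ell+1}\left(1+\frac{1-c+\ell(1-3c)}{2(1-c)}\cdot\frac1n+O\!\left(\frac1{n^2}\right)\right).$$ (ii) When $m=n$, as $n\to\infty$, $$\mathbb E(\pi_1)=\frac n2\left(1-\sqrt{\frac{\pi}{2n}}+\frac{10}{3n}+O(n^{-1/2})\right),\qquad \mathbb E(\pi_1^2)=\frac{n^2}{3}\left(1-\frac{3\sqrt{2\pi}}{4\sqrt n}+\frac{11}{2n}+O(n^{-1/2})\right).$$
   Context: $\mathrm{PF}(m,n)$ is the set of sequences $\pi=(\pi_1,\dots,\pi_m)\in\{1,\dots,n\}^m$ such that, when spots $1,\dots,n$ are initially empty and for $i=1,\dots,m$ in turn car $i$ parks in the first empty spot among $\pi_i,\pi_i+1,\dots,n$, every car parks. In (ii), $\pi$ inside the square roots denotes the constant $3.14159\ldots$. *)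

(* Defs.v *)
From mathcomp Require Import all_boot all_order all_algebra.
From mathcomp Require Import reals.

Set Implicit Arguments.
Unset Strict Implicit.
Unset Printing Implicit Defensive.

Import Order.TTheory GRing.Theory Num.Theory.

Local Open Scope ring_scope.

(* Spot number s + 1 of the street is encoded by s : 'I_n. *)

(* [enum 'I_n] is increasing, so the head of the filtered list is the first
   spot at or after [p] outside [occ]. *)
Definition first_empty (n : nat) (occ : {set 'I_n}) (p : 'I_n) : option 'I_n :=
  ohead [seq s : 'I_n <- enum 'I_n | (p <= s)%N && (s \notin occ)].

Fixpoint all_park (n : nat) (occ : {set 'I_n}) (prefs : seq 'I_n) : bool :=
  if prefs is p :: prefs' then
    if first_empty occ p is Some s then all_park (s |: occ) prefs' else false
  else true.

Definition PF (m n : nat) : {set m.-tuple 'I_n} :=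
  [set t : m.-tuple 'I_n | all_park set0 t].

(* The preference of the first car as a number in {1, ..., n}; the default
   value 0 is only reached when there are no cars (m = 0). *)
Definition pref1 (m n : nat) (t : m.-tuple 'I_n) : nat :=
  head 0%N [seq (val s).+1 | s <- t].

Definition unif_expectation (R : realType) (T : finType) (A : {set T})
    (X : T -> R) : R :=
  (\sum_(t in A) X t) / #|A|%:R.

Definition moment1 (R : realType) (m n l : nat) : R :=
  unif_expectation (PF m n) (fun t => (pref1 t)%:R ^+ l).

(* Main.v *)
Require Import Defs.
From mathcomp Require Import all_boot all_order all_algebra.
From mathcomp Require Import all_classical all_reals all_analysis.
From mathcomp Require Import ring lra zify.
Import Order.TTheory GRing.Theory Num.Theory.
Import numFieldNormedType.Exports.

(* Let [M = m - 1]. The cars other than the first park on their own, leaving a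
   last empty spot [n - L], and then the first car parks iff
   [pi_1 <= n - L]. So, [rho] being uniform in [PF(M, n)],
   [E f(pi_1) = E (f(1) + ... + f(n - L)) / E (n - L)].
   Emptying the street spot by spot from the left gives, through the binomial
   theorem, [|PF(m, n)| = (n + 1 - m) (n + 1) ^ (m - 1)] and the law of [L],
   whose weights are the summands of Abel's binomial identity.
   (i) For [m = c n], [E L] is explicit and the law of [L] has a geometric tail
   by Chernoff's bound, so the power sums may be expanded to second order.
   (ii) For [m = n] the displayed terms beyond the leading one are all absorbed
   in [O(n^(-1/2))], so that it suffices to show [E (n - L)(L + 1) = O(n^(3/2))].
   This is a second kind of Abel sum: iterating Abel's identity, its normalised
   value satisfies [tau_(N+1) = 1 + (N + 1) / z * tau_N], hence is [O(sqrt z)]. *)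

Set Implicit Arguments.
Unset Strict Implicit.
Unset Printing Implicit Defensive.

(** * Parking functions and occupation numbers *)

Section Parking.
Variable n : nat.
Implicit Types (occ : {set 'I_n}) (p : 'I_n).

Definition occ_from occ v := #|[set s in occ | v <= s]|.

Lemma first_emptyP occ p :
  match first_empty occ p with
  | Some s => [/\ p <= s, s \notin occ & forall q : 'I_n, p <= q < s -> q \in occ]
  | None => forall q : 'I_n, p <= q -> q \in occ
  end.
Proof.
rewrite /first_empty.
set P := fun s : 'I_n => _.
have Hsort : sorted (fun a b : 'I_n => a < b) [seq s <- enum 'I_n | P s].
  apply: sorted_filter; first by move=> a b c; apply: ltn_trans.
  by have := iota_ltn_sorted 0 n; rewrite -val_enum_ord sorted_map.
have Hmem q : (q \in [seq s <- enum 'I_n | P s]) = P q.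
  by rewrite mem_filter mem_enum andbT.
case: [seq s <- enum 'I_n | P s] Hsort Hmem => [|s l] /= Hsort Hmem.
  move=> q pq; apply/negPn/negP => qo.
  by have := Hmem q; rewrite /P pq qo.
have /andP[ps so] : P s by rewrite -Hmem mem_head.
split=> // q /andP[pq qs]; apply/negPn/negP => qo.
have : q \in s :: l by rewrite Hmem /P pq qo.
rewrite inE => /orP[/eqP qs'|ql]; first by rewrite qs' ltnn in qs.
move: Hsort; rewrite path_sortedE; last by move=> a b c; apply: ltn_trans.
by case/andP => /allP/(_ _ ql); rewrite ltnNge (ltnW qs).
Qed.

Lemma occ_fromS occ (q : 'I_n) :
  occ_from occ q = (q \in occ) + occ_from occ q.+1.
Proof.
rewrite /occ_from (cardsD1 q) inE leqnn andbT; congr (_ + _).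
apply: eq_card => s; rewrite !inE ltn_neqAle -val_eqE /= [q == s :> nat]eq_sym.
by rewrite andbCA.
Qed.

Lemma occ_from_ge occ v : n <= v -> occ_from occ v = 0.
Proof.
move=> nv; apply/eqP; rewrite cards_eq0; apply/eqP/setP => s; rewrite !inE.
by rewrite leqNgt (leq_trans (ltn_ord s) nv) andbF.
Qed.

Lemma occ_from0 v : occ_from finset.set0 v = 0.
Proof. by apply/eqP; rewrite cards_eq0; apply/eqP/setP => s; rewrite !inE. Qed.

Lemma occ_from_interval occ (u v : nat) : u <= v <= n ->
  (forall q : 'I_n, u <= q < v -> q \in occ) ->
  occ_from occ u = occ_from occ v + (v - u).
Proof.
move=> /andP[uv vn] Hocc.
suff H k : k <= v - u -> occ_from occ (v - k) = occ_from occ v + k.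
  by rewrite -H // subKn.
elim: k => [|k IHk] kv; first by rewrite subn0 addn0.
have ltn : v - k.+1 < n by lia.
rewrite (occ_fromS occ (Ordinal ltn)) Hocc /=; last by lia.
by rewrite subnSK ?IHk; lia.
Qed.

Lemma occ_from_le occ (u v : nat) : u <= v <= n ->
  occ_from occ u <= occ_from occ v + (v - u).
Proof.
move=> /andP[uv vn].
suff H k : k <= v - u -> occ_from occ (v - k) <= occ_from occ v + k.
  by have := H (v - u); rewrite subKn //; apply.
elim: k => [|k IHk] kv; first by rewrite subn0 addn0.
have ltn : v - k.+1 < n by lia.
rewrite (occ_fromS occ (Ordinal ltn)) /= subnSK; last by lia.
by have := IHk (ltnW kv); case: (_ \in _); lia.
Qed.

Lemma occ_from_add occ (s : 'I_n) v : s \notin occ ->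
  occ_from (s |: occ) v = (v <= s) + occ_from occ v.
Proof.
move=> so; rewrite /occ_from; case: leqP => vs /=.
  rewrite (cardsD1 s) !inE eqxx vs; congr (_ + _).
  apply: eq_card => q; rewrite !inE; case: eqVneq => //= ->.
  by rewrite (negPf so).
apply: eq_card => q; rewrite !inE; case: eqVneq => //= ->.
by rewrite (negPf so) /= leqNgt vs.
Qed.

(* Occupied spots count as cars already parked where they wanted to be. *)
Lemma all_parkP occ (ps : seq 'I_n) :
  (forall v, v <= n -> occ_from occ v <= n - v) ->
  reflect (forall v, v <= n -> count (fun p : 'I_n => v <= p) ps + occ_from occ v <= n - v)
          (all_park occ ps).
Proof.
elim: ps occ => [|p ps IHps] occ Hocc /=; first exact: ReflectT.
have := first_emptyP occ p; case: first_empty => [s [ps' so ps_occ]|ps_occ]; last first.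
  (* With every spot from [p] on occupied, the inequality at [v = p] fails. *)
  apply: ReflectF => H; have := H p (ltnW (ltn_ord p)).
  rewrite (@occ_from_interval occ p n); last 2 first.
  - by rewrite (ltnW (ltn_ord p)) leqnn.
  - by move=> q /andP[pq _]; apply: ps_occ.
  by rewrite leqnn occ_from_ge //=; have := ltn_ord p; lia.
have gap v : p < v <= s -> occ_from occ p = occ_from occ v + (v - p).
  move=> /andP[pv vs]; apply: occ_from_interval.
    by rewrite (ltnW pv) (leq_trans vs) // ltnW.
  by move=> q /andP[pq qv]; apply: ps_occ; rewrite pq (leq_trans qv).
have cnt v : p < v -> count (fun q : 'I_n => v <= q) ps <= count (fun q : 'I_n => p <= q) ps.
  by move=> pv; apply: sub_count => q /=; apply: leq_trans; apply: ltnW.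
have sn := ltn_ord s.
have Hs : occ_from occ s = occ_from occ s.+1 by rewrite occ_fromS (negPf so).
have Hocc' v : v <= n -> occ_from (s |: occ) v <= n - v.
  move=> vn; rewrite occ_from_add //; case: (leqP v s) => vs /=; last exact: Hocc.
  have := @occ_from_le occ v s; rewrite vs ltnW // => /(_ isT).
  by have := Hocc s.+1 sn; lia.
apply: (iffP (IHps _ Hocc')) => H v vn; have := H v vn; rewrite occ_from_add //.
  by case: (leqP v p) => vp; [rewrite (leq_trans vp ps') | ]; lia.
case: (leqP v s) => vs /=; last by lia.
case: (leqP v p) => vp /=; first by lia.
(* For [p < v <= s] the spots from [p] to [v - 1] are all occupied, so the inequality at [p], which
   counts the new car, yields the one at [v]. *)
have := gap v; rewrite vp vs => /(_ isT) gv.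
have := H p (ltnW (ltn_ord p)); rewrite leqnn.
by have := cnt v vp; lia.
Qed.

End Parking.

Definition counts n (s : seq nat) : seq nat :=
  foldr (fun j c => incr_nth c j) (nseq n 0) s.

(** Recursive on the first spot, in step with the inductions that peel spots off the left end of the
    street. *)
Fixpoint parkable (c : seq nat) : bool :=
  if c is k :: c' then (k + sumn c' <= (size c').+1) && parkable c' else true.

Lemma parkableP (c : seq nat) :
  reflect (forall v, v <= size c -> sumn (drop v c) <= size c - v) (parkable c).
Proof.
elim: c => [|k c IHc] /=; first by apply: ReflectT => -[].
apply: (iffP andP) => [[kc /IHc H] [|v] //= vc|H]; first exact: H.
split; first exact: (H 0).
by apply/IHc => v vc; apply: (H v.+1).
Qed.

Lemma sumn_drop_incr_nth (c : seq nat) v j :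
  sumn (drop v (incr_nth c j)) = (v <= j) + sumn (drop v c).
Proof.
have incr_nil u i : sumn (drop u (incr_nth [::] i)) = (u <= i) + 0.
  elim: i u => [|i IHi] [|u] //=; last by rewrite -IHi; case: i {IHi}.
  by have := IHi 0; rewrite drop0 => <-; case: i {IHi}.
elim: c v j => [|k c IHc] v j; first exact: incr_nil.
case: v j => [|v] [|j] //=; last exact: IHc.
  by have := IHc 0 j; rewrite !drop0 => ->; rewrite /= add1n addnCA.
Qed.

Lemma size_counts n (ps : seq 'I_n) : size (counts n (map val ps)) = n.
Proof.
elim: ps => [|p ps IHps] /=; first by rewrite size_nseq.
by rewrite size_incr_nth IHps ltn_ord.
Qed.

Lemma sumn_drop_counts n (ps : seq 'I_n) v :
  sumn (drop v (counts n (map val ps))) = count (fun p : 'I_n => v <= p) ps.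
Proof.
elim: ps => [|p ps IHps] /=; last by rewrite sumn_drop_incr_nth IHps.
by rewrite drop_nseq sumn_nseq mul0n.
Qed.

(** On an empty street the criterion of [all_parkP] sees the preferences only through the number of
    cars preferring each spot; in particular the order of the cars is immaterial. *)
Lemma mem_PF m n (t : m.-tuple 'I_n) :
  (t \in PF m n) = parkable (counts n (map val t)).
Proof.
rewrite inE; apply/all_parkP/parkableP => [v vn|H v|H v].
- by rewrite occ_from0.
- by rewrite size_counts sumn_drop_counts => /H; apply: leq_trans; apply: leq_addr.
- move=> vn; have := H v; rewrite size_counts sumn_drop_counts => /(_ vn).
  by rewrite occ_from0 addn0.
Qed.

Local Open Scope ring_scope.

(** * Sums over preferences, one spot at a time *)

Section OccupationNumbers.
Variable R : realFieldType.

(* The sum of [Phi (counts n s)] over all sequences [s] of [m] preferences in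
   [n] spots, organised by the set of cars preferring the first spot. *)
Fixpoint hist_sum (n m : nat) (Phi : seq nat -> R) : R :=
  if n is n'.+1 then
    \sum_(k < m.+1) hist_sum n' (m - k) (fun c => Phi ((k : nat) :: c)) *+ 'C(m, k)
  else if m == 0%N then Phi [::] else 0.

Lemma eq_hist_sum n m (Phi Psi : seq nat -> R) :
  (forall c, size c = n -> sumn c = m -> Phi c = Psi c) ->
  hist_sum n m Phi = hist_sum n m Psi.
Proof.
elim: n m Phi Psi => [|n IHn] m Phi Psi H /=.
  by case: eqP => // m0; apply: H.
apply: eq_bigr => k _; congr (_ *+ _); apply: IHn => c cn cm.
by apply: H => /=; rewrite ?cn // cm subnKC // -ltnS.
Qed.

Lemma hist_sum_linear n m (a : R) (Phi : seq nat -> R) :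
  hist_sum n m (fun c => a * Phi c) = a * hist_sum n m Phi.
Proof.
elim: n m Phi => [|n IHn] m Phi /=; first by case: eqP; rewrite ?mulr0.
by rewrite mulr_sumr; apply: eq_bigr => k _; rewrite IHn mulrnAr.
Qed.

(** Pascal's rule for one distinguished car: either it prefers the first spot, or induction
    distributes it over the others. *)
Lemma hist_sumS n m (Phi : seq nat -> R) :
  hist_sum n m.+1 Phi =
  \sum_(j < n) hist_sum n m (fun c => Phi (incr_nth c j)).
Proof.
elim: n m Phi => [|n IHn] m Phi; first by rewrite big_ord0.
rewrite [RHS]big_ord_recl /= big_ord_recl /= bin0 mulr1n.
under eq_bigr => k _ do rewrite /= /bump /= add1n binS mulrnDr subSS.
rewrite big_split /= addrA [RHS]addrC; congr (_ + _).
rewrite exchange_big /=.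
transitivity (\sum_(k < m.+1) hist_sum n (m - k).+1 (fun c => Phi ((k : nat) :: c)) *+ 'C(m, k));
  last by apply: eq_bigr => k _; rewrite IHn sumrMnl.
transitivity (\sum_(k < m.+2) hist_sum n (m.+1 - k) (fun c => Phi ((k : nat) :: c)) *+ 'C(m, k)).
  by rewrite [RHS]big_ord_recl /= bin0 mulr1n.
rewrite big_ord_recr /= bin_small // mulr0n addr0.
by apply: eq_bigr => k _; rewrite subSn // -ltnS.
Qed.

Lemma big_tupleS (T : finType) m (f : m.+1.-tuple T -> R) :
  \sum_t f t = \sum_x \sum_(t : m.-tuple T) f [tuple of x :: t].
Proof.
rewrite pair_big /=.
rewrite (reindex (fun p : T * m.-tuple T => [tuple of p.1 :: p.2])) //=.
exists (fun t => (thead t, [tuple of behead t])) => [[x t] _ | t _] /=.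
  by congr (_, _); apply/val_inj.
by rewrite [t in RHS]tuple_eta.
Qed.

Lemma sum_tuple_hist n m (Phi : seq nat -> R) :
  \sum_(t : m.-tuple 'I_n) Phi (counts n (map val t)) = hist_sum n m Phi.
Proof.
elim: m Phi => [|m IHm] Phi.
  rewrite (eq_bigr (fun=> Phi (nseq n 0%N))) => [|t _]; last by rewrite tuple0.
  rewrite sumr_const card_tuple expn0 mulr1n.
  elim: n Phi => [|n IHn] Phi //=.
  by rewrite big_ord_recl big_ord0 addr0 /= bin0 mulr1n -IHn.
rewrite big_tupleS hist_sumS; apply: eq_bigr => j _.
by rewrite -IHm.
Qed.

End OccupationNumbers.

(** * Counting parking functions *)

Section Counting.
Variable R : realFieldType.

(* The number of parking functions of [m] cars on [N - 1] spots. *)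
Definition pf (m N : nat) : R := N%:R ^+ m - m%:R * N%:R ^+ m.-1.

Lemma pf0 N : pf 0 N = 1.
Proof. by rewrite /pf mul0r subr0. Qed.

Lemma pf_diag m : (0 < m)%N -> pf m m = 0.
Proof. by case: m => // m _; rewrite /pf /= -exprS subrr. Qed.

Lemma natrX_binomial m N :
  \sum_(k < m.+1) (N%:R ^+ (m - k) : R) *+ 'C(m, k) = N.+1%:R ^+ m.
Proof.
rewrite -natr1 exprDn; apply: eq_bigr => k _.
by rewrite expr1n mulr1.
Qed.

(** The recursion for a new first spot preferred by [k] cars. Both terms of [pf] obey the binomial
    theorem, the second one after [(m - k) C(m, k) = m C(m - 1, k)]. *)
Lemma pf_binomial m N : \sum_(k < m.+1) pf (m - k) N *+ 'C(m, k) = pf m N.+1.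
Proof.
under eq_bigr => k _ do rewrite /pf mulrnBl.
rewrite sumrB natrX_binomial /pf; congr (_ - _).
case: m => [|m]; first by rewrite big_ord_recl big_ord0 subn0 !mul0r mul0rn addr0.
rewrite big_ord_recr /= subnn mul0r mul0rn addr0 -natrX_binomial mulr_sumr.
apply: eq_bigr => k _.
rewrite subSn; last by rewrite -ltnS.
rewrite /= -[LHS]mulr_natr -[X in _ = _ * X]mulr_natr; set a := _ ^+ _.
have := mul_bin_down m.+1 k; rewrite subSn; last by rewrite -ltnS.
move=> /(congr1 (fun z => z%:R : R)); rewrite !natrM /= => H.
by rewrite [in RHS]mulrCA H mulrCA mulrA.
Qed.

(* Abel's summand: [block 1 M n i] counts the parking functions of [M] cars on
   [n] spots whose last empty spot is followed by exactly [i] occupied ones. *)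
Definition block x M n i : R := pf i (i + x) * pf (M - i) (n - i) *+ 'C(M, i).

Lemma block_small x M n i : (M < i)%N -> block x M n i = 0.
Proof. by move=> Mi; rewrite /block bin_small. Qed.

(** Two disjoint sets of cars may be chosen in either order: [C(M, k) C(M - k, i) = C(M, i) C(M - i,
    k)]. *)
Lemma binomial_convolution (g : nat -> R) M i : (i <= M)%N ->
  \sum_(k < M.+1) g (M - k - i)%N *+ 'C(M - k, i) *+ 'C(M, k) =
  (\sum_(k < (M - i).+1) g (M - i - k)%N *+ 'C(M - i, k)) *+ 'C(M, i).
Proof.
move=> iM; rewrite -sumrMnl.
rewrite (big_ord_widen M.+1 (fun k => g (M - i - k)%N *+ 'C(M - i, k) *+ 'C(M, i))); last by rewrite ltnS leq_subr.
rewrite [RHS]big_mkcond /=; apply: eq_bigr => k _.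
case: ltnP => kMi; last by rewrite (@bin_small (M - k)) ?mulr0n ?mul0rn //; have := ltn_ord k; lia.
rewrite -!mulrnA subnAC; congr (_ *+ _).
have kM : (k <= M)%N by lia.
have E1 := bin_fact kM; have E2 := @bin_fact (M - k) i ltac:(lia).
have E3 := bin_fact iM; have E4 := @bin_fact (M - i) k ltac:(lia).
have E5 : (M - k - i = M - i - k)%N by lia.
apply/eqP; rewrite -(eqn_pmul2r (fact_gt0 k)) -(eqn_pmul2r (fact_gt0 i)) -(eqn_pmul2r (fact_gt0 (M - i - k))).
apply/eqP.
transitivity (M`!)%N; first by rewrite -E1 -E2 E5; ring.
by rewrite -E3 -E4; ring.
Qed.

(** Only the second [pf] factor sees a spot added on the left, so [pf_binomial] applies to it. *)
Lemma block_binomial x M n i : (M <= n)%N ->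
  \sum_(k < M.+1) block x (M - k) n i *+ 'C(M, k) = block x M n.+1 i.
Proof.
move=> Mn; have [Mi|iM] := ltnP M i.
  rewrite block_small // big1 // => k _; rewrite block_small ?mul0rn //; lia.
under eq_bigr => k _ do rewrite /block -mulrnAr -mulrnAr.
rewrite -mulr_sumr (@binomial_convolution (fun a => pf a (n - i))) //.
by rewrite pf_binomial -subSn ?mulrnAr //; lia.
Qed.

(** For [M = n] only [i = M] survives, since [pf m m = 0] for [m > 0]. Each further spot is handled
    by [block_binomial] on the left and [pf_binomial] on the right. *)
Lemma sum_block x M n : (M <= n)%N ->
  \sum_(i < M.+1) block x M n i = pf M (n + x).
Proof.
have diag m : \sum_(i < m.+1) block x m m i = pf m (m + x).
  rewrite big_ord_recr /= /block subnn pf0 mulr1 binn mulr1n big1 ?add0r // => i _.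
  by rewrite pf_diag ?mulr0 ?mul0rn // subn_gt0.
elim: n M => [|n IHn] M; first by rewrite leqn0 => /eqP ->.
rewrite leq_eqVlt => /predU1P[-> //|]; rewrite ltnS => Mn.
under eq_bigr => i _ do rewrite -(block_binomial _ _ Mn).
rewrite exchange_big /= addSn -pf_binomial; apply: eq_bigr => k _.
rewrite -IHn; last by rewrite (leq_trans (leq_subr _ _)).
rewrite sumrMnl [in RHS](big_ord_widen M.+1 (fun i => block x (M - k) n i)); last by lia.
congr (_ *+ _); rewrite [RHS]big_mkcond /=; apply: eq_bigr => i _.
by case: ltnP => // ?; rewrite block_small.
Qed.

Lemma hist_sum_gt n m (Phi : seq nat -> bool) : (n < m)%N ->
  (forall c, size c = n -> Phi c -> (sumn c <= n)%N) ->
  hist_sum n m (fun c => (Phi c)%:R : R) = 0.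
Proof.
move=> nm H; rewrite (eq_hist_sum (Psi := fun c => 0 * 0)) => [|c cn cm].
  by rewrite hist_sum_linear mul0r.
by rewrite mul0r; case P: (Phi c) => //; have := H c cn P; rewrite cm leqNgt nm.
Qed.

Lemma parkable_sumn c : parkable c -> (sumn c <= size c)%N.
Proof. by case: c => // k c /andP[]. Qed.

Lemma hist_sum_parkable n m : (m <= n)%N ->
  hist_sum n m (fun c => (parkable c)%:R : R) = pf m n.+1.
Proof.
elim: n m => [|n IHn] m mn; first by case: m mn => // _; rewrite /= pf0.
rewrite -pf_binomial /=; apply: eq_bigr => k _; congr (_ *+ _).
rewrite (eq_hist_sum (Psi := fun c => (parkable c)%:R)) => [|c -> cm]; last first.
  by rewrite cm subnKC ?mn // -ltnS.
have [|nmk] := leqP (m - k)%N n; first exact: IHn.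
(* This case leaves [n.+1] cars for [n] spots: nothing is parkable, and [pf] vanishes as well. *)
have -> : (m - k = n.+1)%N by lia.
by rewrite pf_diag // hist_sum_gt // => c <-; apply: parkable_sumn.
Qed.

End Counting.

(** * Adding the first car *)

Section FirstCar.
Variable R : realFieldType.

Lemma sumn_incr_nth (c : seq nat) j : sumn (incr_nth c j) = (sumn c).+1.
Proof. by have := sumn_drop_incr_nth c 0 j; rewrite !drop0. Qed.

(** A further car preferring [j] parks iff [j] is not beyond the last empty spot, that is, iff fewer
    than [n - j] spots follow that one. The induction peels the first spot on both sides until
    [j = 0], where any spare spot suffices and [sum_block] gives the total. *)
Lemma hist_sum_parkable_incr n M j : (M <= n)%N -> (j < n)%N ->
  hist_sum n M (fun c => (parkable (incr_nth c j))%:R : R) =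
  \sum_(i < M.+1 | (i < n - j)%N) block R 1 M n i.
Proof.
elim: n M j => [//|n IHn] M j; rewrite leq_eqVlt => /predU1P[->|Mn] jn.
  (* As many cars as spots: no further car parks, and each weight has a factor [pf m m = 0]. *)
  rewrite big1 => [|i Hi]; last by rewrite /block pf_diag ?mulr0 ?mul0rn //; lia.
  rewrite (eq_hist_sum (Psi := fun c => 0 * 0)) => [|c cn cm].
    by rewrite hist_sum_linear mul0r.
  rewrite mul0r; case P: (parkable _) => //; have := parkable_sumn P.
  by rewrite sumn_incr_nth size_incr_nth cn cm jn ltnn.
rewrite ltnS in Mn; case: j jn => [|j] jn /=.
  rewrite subn0 [RHS](eq_bigl predT); last by move=> i /=; apply: (leq_trans (ltn_ord i)).
  rewrite sum_block ?addn1; last by rewrite leqW.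
  rewrite -pf_binomial; apply: eq_bigr => k _; congr (_ *+ _).
  rewrite -hist_sum_parkable; last by rewrite (leq_trans (leq_subr _ _)).
  apply: eq_hist_sum => c -> ->.
  by rewrite addSn subnKC ?ltnS ?Mn // -ltnS.
transitivity (\sum_(k < M.+1) \sum_(i < M.+1 | (i < n - j)%N) block R 1 (M - k) n i *+ 'C(M, k)).
  apply: eq_bigr => k _; rewrite sumrMnl; congr (_ *+ _).
  rewrite (eq_hist_sum (Psi := fun c => (parkable (incr_nth c j))%:R)); last first.
    move=> c cn cm /=; rewrite sumn_incr_nth size_incr_nth cn -[(j < n)%N]ltnS jn cm.
    by rewrite (_ : k + (M - k).+1 <= n.+1)%N //; have := ltn_ord k; lia.
  rewrite IHn //; last by rewrite (leq_trans (leq_subr _ _)).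
  rewrite [LHS]big_mkcond [RHS]big_mkcond /=.
  rewrite [LHS](big_ord_widen M.+1 (fun i => if (i < n - j)%N then block R 1 (M - k) n i else 0)); last by lia.
  rewrite [LHS]big_mkcond; apply: eq_bigr => i _.
  by case: ltnP => // ?; rewrite block_small ?if_same.
rewrite exchange_big subSS; apply: eq_bigr => i _.
exact: block_binomial.
Qed.

(** As the order of the cars is immaterial, the first car may be added last. After exchanging the
    sums its preference ranges over the [n - i] spots up to the last empty one. *)
Lemma sum_PF n M (f : nat -> R) : (M < n)%N ->
  \sum_(t in PF M.+1 n) f (pref1 t) =
  \sum_(i < M.+1) block R 1 M n i * \sum_(j < n - i) f j.+1.
Proof.
move=> Mn; rewrite big_mkcond big_tupleS /=.
transitivity (\sum_(j < n) f j.+1 * \sum_(i < M.+1 | (i < n - j)%N) block R 1 M n i).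
  apply: eq_bigr => j _.
  rewrite -hist_sum_parkable_incr // 1?ltnW // -sum_tuple_hist mulr_sumr.
  by apply: eq_bigr => t _; rewrite mem_PF /=; case: parkable; rewrite ?mulr1 ?mulr0.
under [LHS]eq_bigr => j _ do rewrite mulr_sumr big_mkcond.
rewrite exchange_big; apply: eq_bigr => i _; rewrite mulr_sumr.
rewrite [RHS](big_ord_widen n (fun j => block R 1 M n i * f j.+1)); last by rewrite leq_subr.
rewrite [RHS]big_mkcond; apply: eq_bigr => j _; rewrite mulrC.
by congr (if _ then _ else _); have := ltn_ord i; have := ltn_ord j; lia.
Qed.

Lemma card_PF m n : (m <= n)%N -> #|PF m n|%:R = pf R m n.+1.
Proof.
move=> mn; rewrite -hist_sum_parkable // -sum_tuple_hist -sum1_card natr_sum big_mkcond.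
by apply: eq_bigr => t _; rewrite mem_PF; case: parkable.
Qed.

(** The case [f = 1] of [sum_PF], read as the unnormalised mean of the last empty spot. *)
Lemma pf_mean n M : (M < n)%N ->
  pf R M.+1 n.+1 = \sum_(i < M.+1) block R 1 M n i * (n - i)%:R.
Proof.
move=> Mn; rewrite -card_PF // -sum1_card natr_sum.
rewrite (sum_PF (fun=> 1)) //; apply: eq_bigr => i _.
by rewrite sumr_const card_ord.
Qed.

(** * Abel's identities *)

(** Abel's binomial identity, as [pf i (i + x) = x (i + x)^(i - 1)] for [i > 0]. Induction on [M]
    through [z^(M + 1) = pf (M + 1) z + (M + 1) z^M], a split made both in the total, with
    [z = n + x], and in each summand, with [z = n - i]. *)
Lemma sum_abel x M n : (M <= n)%N ->
  \sum_(i < M.+1) (pf R i (i + x) * (n - i)%:R ^+ (M - i)) *+ 'C(M, i) = (n + x)%:R ^+ M.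
Proof.
elim: M => [|M IHM] Mn; first by rewrite big_ord_recl big_ord0 subn0 pf0 !expr0 mulr1 addr0.
have -> : (n + x)%:R ^+ M.+1 = pf R M.+1 (n + x) + M.+1%:R * (n + x)%:R ^+ M.
  by rewrite /pf subrK.
rewrite -sum_block // -IHM; last exact: ltnW.
rewrite mulr_sumr.
transitivity (\sum_(i < M.+2) (block R x M.+1 n i +
   pf R i (i + x) * ((M.+1 - i)%:R * (n - i)%:R ^+ (M.+1 - i).-1) *+ 'C(M.+1, i))).
  apply: eq_bigr => i _; rewrite /block -mulrnDl -mulrDr; congr (_ * _ *+ _).
  by rewrite /pf subrK.
rewrite big_split /=; congr (_ + _).
rewrite big_ord_recr /= subnn mul0r mulr0 mul0rn addr0; apply: eq_bigr => i _.
have iM : (i <= M)%N by rewrite -ltnS.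
rewrite subSn //= -[LHS]mulr_natr -[X in _ = _ * X]mulr_natr.
have := mul_bin_down M.+1 i; rewrite subSn //=.
move=> /(congr1 (fun z => z%:R : R)); rewrite !natrM => H.
set a := pf _ _ _; set b := _ ^+ _.
by rewrite [RHS]mulrCA H; ring.
Qed.

(** The Abel sum [A_N(x, 1; 0, 0)] in Riordan's notation; [sum_abel] evaluates sums of type
    [(-1, 0)]. This one has no closed form, only a recursion. *)
Definition abel2 N x : R :=
  \sum_(k < N.+1) ((x + k)%:R ^+ k * (N.+1 - k)%:R ^+ (N - k)) *+ 'C(N, k).

(** Split [(x + i)^i = pf i (x + i) + i (x + i)^(i - 1)]. The first part is Abel's identity; in the
    second, [i C(N + 1, i) = (N + 1) C(N, i - 1)] shifts the index. The sum [N + x] is preserved, so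
    the base of the power stays the same when iterating. *)
Lemma abel2_rec N x : abel2 N.+1 x = (N.+2 + x)%:R ^+ N.+1 + N.+1%:R * abel2 N x.+1.
Proof.
rewrite -sum_abel // /abel2 mulr_sumr.
transitivity (\sum_(i < N.+2) ((pf R i (i + x) * (N.+2 - i)%:R ^+ (N.+1 - i)) *+ 'C(N.+1, i) +
   (i%:R * (x + i)%:R ^+ i.-1) * (N.+2 - i)%:R ^+ (N.+1 - i) *+ 'C(N.+1, i))).
  apply: eq_bigr => i _; rewrite -mulrnDl -mulrDl; congr (_ * _ *+ _).
  by rewrite /pf addnC subrK.
rewrite big_split /=; congr (_ + _).
rewrite big_ord_recl /= !mul0r mul0rn add0r; apply: eq_bigr => i _.
rewrite /= /bump /= add1n !subSS addnS addSn -[LHS]mulr_natr -[X in _ = _ * X]mulr_natr.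
have := mul_bin_diag N.+1 i.
move=> /(congr1 (fun z => z%:R : R)); rewrite !natrM => H.
set a := _ ^+ i; set b := _ ^+ _.
by rewrite [RHS]mulrCA H; ring.
Qed.
End FirstCar.

Lemma moment1E (R : realType) n M l : (M < n)%N ->
  moment1 R M.+1 n l =
  (\sum_(i < M.+1) block R 1 M n i * \sum_(j < n - i) j.+1%:R ^+ l) / pf R M.+1 n.+1.
Proof.
move=> Mn; rewrite /moment1 /unif_expectation card_PF //; congr (_ / _).
by rewrite -(sum_PF (fun k => k%:R ^+ l) Mn).
Qed.

(** * Signs of the weights and size of the second Abel sum *)

Section Blocks.
Variable R : realFieldType.

Lemma pf_ge0 m N : (m <= N)%N -> 0 <= pf R m N.
Proof.
case: m => [|m] mN; first by rewrite pf0 ler01.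
by rewrite /pf /= exprS -mulrBl mulr_ge0 ?exprn_ge0 // subr_ge0 ler_nat.
Qed.

Lemma block_ge0 x M n i : (M <= n)%N -> 0 <= block R x M n i.
Proof.
move=> Mn; rewrite /block mulrn_wge0 // mulr_ge0 // pf_ge0 ?leq_addr //.
by rewrite leq_sub2r.
Qed.

Lemma pf_succ i : i.+1%:R * pf R i i.+1 = i.+1%:R ^+ i.
Proof.
case: i => [|i]; first by rewrite pf0 mulr1.
by rewrite /pf /= [in RHS]exprS exprS -mulrBl -natrB // subSnn mul1r.
Qed.

(** By [pf_succ] the factors [i + 1] and [M + 1 - i] turn both [pf] factors of the weight into pure
    powers. *)
Lemma sum_block_abel2 M :
  \sum_(i < M.+1) block R 1 M M.+1 i * ((M.+1 - i)%:R * i.+1%:R) = abel2 R M 1.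
Proof.
apply: eq_bigr => i _; rewrite /block mulrnAl; congr (_ *+ _).
have iM : (i <= M)%N by rewrite -ltnS.
rewrite addn1 add1n -pf_succ subSn // -(pf_succ (M - i)).
by ring.
Qed.

(** For [tau_N = abel2 / z^N] with [z] fixed, the recursion is
    [tau_(N+1) = 1 + (N + 1) / z * tau_N]. As long as [N + 1 <= z - s], the factor is at most
    [1 - 1 / s] and the bound [s] reproduces itself; afterwards the factor is at most 1, so the
    bound grows by at most 1 per step. *)
Lemma abel2_le (s : R) z N x : 0 < s -> s ^+ 2 = z%:R -> (N + x).+1 = z -> 1 <= s ->
  abel2 R N x <= z%:R ^+ N * (s + Num.max 0 (N%:R + 1 - z%:R + s)).
Proof.
move=> s0 sz + s1; elim: N x => [|N IHN] x Nxz.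
  rewrite /abel2 big_ord_recl big_ord0 /= !expr0 !mul1r bin0 mulr1n addr0.
  by rewrite (le_trans s1) // lerDl le_max lexx.
rewrite abel2_rec; have -> : (N.+2 + x)%N = z by lia.
have zN : 0 <= z%:R ^+ N :> R by rewrite exprn_ge0.
have Nz : N.+1%:R <= z%:R :> R by rewrite ler_nat; lia.
have N0 : 0 <= N.+1%:R :> R by [].
have {IHN} := IHN x.+1; rewrite addnS => /(_ Nxz) IH.
apply: (le_trans (y := z%:R ^+ N.+1 + N.+1%:R * (z%:R ^+ N * (s + Num.max 0 (N%:R + 1 - z%:R + s))))).
  by rewrite lerD2l ler_wpM2l.
rewrite exprS mulrCA [_ * z%:R ^+ N]mulrC -mulrDr -mulrA ler_wpM2l //.
rewrite -natr1 in Nz N0 *; have := ler0n R N.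
move: sz Nz N0; move: (z%:R : R) (N%:R : R) => y u sz uy u0 u0'.
case: (leP (u + 1 - y + s) 0) => H1; case: (leP (u + 1 + 1 - y + s) 0) => H2; nra.
Qed.

End Blocks.

(** * The case m = n *)

Section FullStreet.
Variables (R : realType) (M : nat).
Let n := M.+1.
(** By [sum_block_abel2] and [pf_mean] this is [E (n - L)(L + 1) / E (n - L)]. *)
Let tau : R := abel2 R M 1 / pf R n n.+1.

Lemma pf_full : pf R n n.+1 = n.+1%:R ^+ M.
Proof.
apply: (mulfI (_ : n.+1%:R != 0 :> R)); first by rewrite pnatr_eq0.
by rewrite pf_succ exprS.
Qed.

Lemma pf_full_gt0 : 0 < pf R n n.+1.
Proof. by rewrite pf_full exprn_gt0 // ltr0n. Qed.

Lemma tau_ge0 : 0 <= tau.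
Proof.
rewrite /tau -sum_block_abel2 divr_ge0 ?(ltW pf_full_gt0) //.
by apply: sumr_ge0 => i _; rewrite mulr_ge0 ?mulr_ge0 ?block_ge0.
Qed.

Lemma tau_le : tau <= 2 * Num.sqrt n.+1%:R.
Proof.
rewrite /tau ler_pdivrMr ?pf_full_gt0 // mulrC pf_full.
have s1 : 1 <= Num.sqrt n.+1%:R :> R by rewrite -{1}[1]sqrtr1 ler_wsqrtr // ler1n.
have ss : Num.sqrt n.+1%:R ^+ 2 = n.+1%:R :> R by rewrite sqr_sqrtr.
apply: (le_trans (abel2_le (lt_le_trans ltr01 s1) ss _ s1)); first by rewrite addn1.
rewrite ler_wpM2l ?exprn_ge0 // mulr2n mulrDl mul1r lerD2l.
rewrite ge_max sqrtr_ge0 /= -[leRHS]add0r lerD2r subr_le0.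
by rewrite natr1 ler_nat leqnSn.
Qed.

Lemma sum_nat1 k : \sum_(j < k) j.+1%:R = k%:R * k.+1%:R / 2 :> R.
Proof.
elim: k => [|k IHk]; first by rewrite big_ord0 !mul0r.
by rewrite big_ord_recr /= IHk -!natr1; field.
Qed.

Lemma sum_nat2 k : \sum_(j < k) j.+1%:R ^+ 2 = k%:R * (k.+1%:R * (2 * k%:R + 1)) / 6 :> R.
Proof.
elim: k => [|k IHk]; first by rewrite big_ord0 !mul0r.
by rewrite big_ord_recr /= IHk -!natr1; field.
Qed.

(** Exact, because [n - i + 1 = (n + 2) - (i + 1)] in the sum of the first [n - i] integers. *)
Lemma moment1_full_1 : moment1 R n n 1 = (n%:R + 2 - tau) / 2.
Proof.
have A0 := lt0r_neq0 pf_full_gt0.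
rewrite moment1E // /tau -sum_block_abel2.
have -> : \sum_(i < M.+1) block R 1 M n i * \sum_(j < n - i) j.+1%:R ^+ 1 =
  ((n%:R + 2) * pf R n n.+1 -
  \sum_(i < M.+1) block R 1 M n i * ((n - i)%:R * i.+1%:R)) / 2 :> R.
  rewrite pf_mean // mulr_sumr -sumrB mulr_suml; apply: eq_bigr => i _.
  under eq_bigr do rewrite expr1.
  rewrite sum_nat1 -natr1 natrB; last by rewrite ltnW.
  by rewrite -[i.+1%:R]natr1; field.
by field.
Qed.

(** Termwise: after removing the common factor [(n - i) / 6], the sum of squares differs from its
    leading term [2 n^2] by at most [4 n (i + 1)]. *)
Lemma moment1_full_2 : `|moment1 R n n 2 - n%:R ^+ 2 / 3| <= 2 / 3 * (n%:R * tau).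
Proof.
have A0 := pf_full_gt0.
rewrite moment1E // -[X in _ - X](mulfK (lt0r_neq0 A0)) -mulrBl normrM normfV (gtr0_norm A0).
rewrite ler_pdivrMr // /tau !mulrA divfK ?gt_eqF // -sum_block_abel2 pf_mean //.
rewrite !mulr_sumr -sumrB; apply: (le_trans (ler_norm_sum _ _ _)).
apply: ler_sum => i _.
have iM : (i <= M)%N by rewrite -ltnS.
rewrite sum_nat2 -natr1 natrB; last by rewrite ltnW.
have := @block_ge0 R 1 M n i (leqnSn M).
have : (i%:R + 1 <= n%:R :> R) by rewrite natr1 ler_nat ltnS.
rewrite -[i.+1%:R]natr1; have : 0 <= i%:R :> R by [].
move: (i%:R : R) (n%:R : R) (block _ _ _ _ _) => q y b q0 qy b0.
have -> : b * ((y - q) * ((y - q + 1) * (2 * (y - q) + 1)) / 6) - y ^+ 2 / 3 * (b * (y - q)) =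
  b * (y - q) * (((y - q + 1) * (2 * (y - q) + 1) - 2 * y ^+ 2) / 6) by field.
have -> : 2 / 3 * y * (b * ((y - q) * (q + 1))) = b * (y - q) * (2 / 3 * y * (q + 1)) by field.
have b' : 0 <= b * (y - q) by rewrite mulr_ge0 //; lra.
rewrite normrM ger0_norm // ler_wpM2l // ler_norml; apply/andP; split; nra.
Qed.

End FullStreet.

(** * The case m = c n *)

Section PowerSums.
Variable R : realFieldType.

Lemma powB_ge0 (a b : R) l : 0 <= a -> a <= b -> 0 <= b ^+ l - a ^+ l.
Proof. by move=> a0 ab; rewrite subr_ge0; apply: lerXn2r => //; rewrite nnegrE // (le_trans a0). Qed.

(** A mean value bound, multiplied by [n] so that no exponent [l - 1] occurs. *)
Lemma powB_le (a b n : R) l : 0 <= a -> a <= b -> b <= n ->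
  n * (b ^+ l - a ^+ l) <= l%:R * (b - a) * n ^+ l.
Proof.
move=> a0 ab bn; have b0 := le_trans a0 ab; have n0 := le_trans b0 bn.
elim: l => [|l IHl]; first by rewrite !expr0 subrr mulr0 !mul0r.
have an : a ^+ l <= n ^+ l by apply: lerXn2r => //; rewrite ?nnegrE // (le_trans ab).
have -> : n * (b ^+ l.+1 - a ^+ l.+1) =
    b * (n * (b ^+ l - a ^+ l)) + (b - a) * n * a ^+ l by rewrite !exprS; ring.
have -> : l.+1%:R * (b - a) * n ^+ l.+1 =
    n * (l%:R * (b - a) * n ^+ l) + (b - a) * n * n ^+ l by rewrite -natr1 !exprS; ring.
have ba : 0 <= (b - a) * n by rewrite mulr_ge0 // subr_ge0.
apply: lerD; last exact: ler_wpM2l.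
apply: (le_trans (ler_wpM2l b0 IHl)); apply: ler_wpM2r => //.
by rewrite !mulr_ge0 ?exprn_ge0 // subr_ge0.
Qed.

(* [2 (l + 1)] times the error of the trapezoidal rule for [x ^+ l] on
   [[a, a + 1]]. *)
Definition trapezoid_err l (a : R) :=
  l.+1%:R * (a ^+ l + (a + 1) ^+ l) - 2 * ((a + 1) ^+ l.+1 - a ^+ l.+1).

Lemma trapezoid_errS l a : trapezoid_err l.+1 a =
  ((a + (a + 1)) * trapezoid_err l a + l.+1%:R * ((a + 1) ^+ l - a ^+ l)) / 2.
Proof. by rewrite /trapezoid_err -[l.+2%:R]natr1 -!natr1 !exprS; field. Qed.

(** Induction by [trapezoid_errS]: the midpoint factor is at most [n], the difference of powers is
    bounded by [powB_le], and [y^3 + y (y + 1) / 2 <= (y + 1)^3] closes the step. *)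
Lemma trapezoid_err_bound l (a n : R) : 0 <= a -> a + 1 <= n ->
  0 <= trapezoid_err l.+1 a /\
  n ^+ 2 * trapezoid_err l.+1 a <= l.+1%:R ^+ 3 * n ^+ l.+1.
Proof.
move=> a0 an; have n0 : 0 <= n by lra.
elim: l => [|l [IH0 IH]].
  have -> : trapezoid_err 1 a = 0 by rewrite /trapezoid_err !expr1; ring.
  by rewrite mulr0 lexx mulr_ge0 // exprn_ge0.
have v0 : 0 <= (a + 1) ^+ l.+1 - a ^+ l.+1 by apply: powB_ge0 => //; lra.
have := @powB_le a (a + 1) n l.+1 a0 _ an.
rewrite (_ : a + 1 - a = 1) ?mulr1; last by ring.
have -> : a <= a + 1 by lra.
move=> /(_ isT) v1; rewrite trapezoid_errS; split.
  apply: mulr_ge0 => //; apply: addr_ge0; apply: mulr_ge0 => //; lra.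
set d := trapezoid_err _ _ in IH0 IH *; set v := _ - _ in v0 v1 *.
have P0 : 0 <= n ^+ l.+1 by rewrite exprn_ge0.
have -> : n ^+ 2 * (((a + (a + 1)) * d + l.+2%:R * v) / 2) =
  (a + (a + 1)) / 2 * (n ^+ 2 * d) + l.+2%:R / 2 * n * (n * v) by field.
have H1 : (a + (a + 1)) / 2 * (n ^+ 2 * d) <= n * (l.+1%:R ^+ 3 * n ^+ l.+1).
  by apply: ler_pM => //; rewrite ?mulr_ge0 ?exprn_ge0 //; lra.
have H2 : l.+2%:R / 2 * n * (n * v) <= l.+2%:R / 2 * n * (l.+1%:R * n ^+ l.+1).
  by apply: ler_wpM2l => //; rewrite !mulr_ge0.
apply: (le_trans (lerD H1 H2)).
have -> : n * (l.+1%:R ^+ 3 * n ^+ l.+1) + l.+2%:R / 2 * n * (l.+1%:R * n ^+ l.+1) =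
   (l.+1%:R ^+ 3 + l.+2%:R / 2 * l.+1%:R) * n ^+ l.+2 by rewrite [n ^+ l.+2]exprS; field.
apply: ler_wpM2r; first by rewrite exprn_ge0.
rewrite -[l.+2%:R]natr1; have := ler0n R l.+1; move: (l.+1%:R : R) => y y0; nra.
Qed.

Definition power_sum l k : R := \sum_(j < k) j.+1%:R ^+ l.

Lemma power_sumS l k : power_sum l k.+1 = power_sum l k + k.+1%:R ^+ l.
Proof. by rewrite /power_sum big_ord_recr. Qed.

(** The integrals telescope, and the trapezoids add up to the power sum less half its last term, the
    term at 0 vanishing because the exponent is positive. *)
Lemma power_sum_trapezoid l k :
  2 * l.+2%:R * (power_sum l.+1 k - k%:R ^+ l.+2 / l.+2%:R - k%:R ^+ l.+1 / 2) =
  \sum_(j < k) trapezoid_err l.+1 j%:R.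
Proof.
have l0 : l.+2%:R != 0 :> R by rewrite pnatr_eq0.
elim: k => [|k IHk]; first by rewrite /power_sum !big_ord0 !expr0n /=; field.
rewrite big_ord_recr -IHk power_sumS /trapezoid_err /= natr1; field.
by rewrite -natrD pnatr_eq0.
Qed.

Lemma power_sum_bound l n : n%:R * `|power_sum l.+1 n - n%:R ^+ l.+2 / l.+2%:R - n%:R ^+ l.+1 / 2|
  <= l.+1%:R ^+ 3 * n%:R ^+ l.+1.
Proof.
case: n => [|n]; first by rewrite mul0r mulr_ge0 // exprn_ge0.
set D := _ - _ - _; set N : R := n.+1%:R.
have N0 : 0 < N by rewrite ltr0n.
have b (j : 'I_n.+1) : j%:R + 1 <= N :> R by rewrite natr1 ler_nat ltn_ord.
have DE : D = (\sum_(j < n.+1) trapezoid_err l.+1 j%:R) / (2 * l.+2%:R).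
  by rewrite -power_sum_trapezoid -/D mulrC mulKf // mulf_neq0 // pnatr_eq0.
have S0 : 0 <= \sum_(j < n.+1) trapezoid_err l.+1 (j%:R : R).
  by apply: sumr_ge0 => j _; case: (@trapezoid_err_bound l j%:R N).
have S1 : N ^+ 2 * \sum_(j < n.+1) trapezoid_err l.+1 (j%:R : R) <= N * (l.+1%:R ^+ 3 * N ^+ l.+1).
  rewrite mulr_sumr [leRHS]mulr_natl -[X in _ *+ X]card_ord -sumr_const.
  by apply: ler_sum => j _; case: (@trapezoid_err_bound l j%:R N).
have c1 : 1 <= 2 * l.+2%:R :> R by rewrite -natrM ler1n.
rewrite DE ger0_norm; last by rewrite divr_ge0 // (le_trans _ c1).
rewrite mulrA ler_pdivrMr ?(lt_le_trans _ c1) //.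
rewrite -(ler_pM2l N0) mulrA -expr2; apply: (le_trans S1).
rewrite ler_pM2l // ler_peMr // mulr_ge0 // exprn_ge0 //; exact: ltW.
Qed.

(** Each of the [i] removed terms is replaced by [n^l], at a cost bounded by [powB_le]. *)
Lemma power_sum_sub l n i : (i <= n)%N ->
  n%:R * `|power_sum l (n - i) - power_sum l n + i%:R * n%:R ^+ l| <= l%:R * i%:R ^+ 2 * n%:R ^+ l.
Proof.
elim: i => [|i IHi] ni; first by rewrite subn0 subrr mul0r addr0 normr0 mulr0 !mulr_ge0 ?exprn_ge0.
have -> : power_sum l (n - i.+1) = power_sum l (n - i) - (n - i)%:R ^+ l.
  by rewrite -[in RHS](subnSK ni) power_sumS addrK.
have -> : power_sum l (n - i) - (n - i)%:R ^+ l - power_sum l n + i.+1%:R * n%:R ^+ l =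
  (power_sum l (n - i) - power_sum l n + i%:R * n%:R ^+ l) + (n%:R ^+ l - (n - i)%:R ^+ l).
  by rewrite -natr1; ring.
have H : (n - i)%:R <= n%:R :> R by rewrite ler_nat leq_subr.
have := @powB_le (n - i)%:R n%:R n%:R l (ler0n R _) H (lexx _).
rewrite natrB; last exact: ltnW.
rewrite -natrB ?(ltnW ni) // in H *; rewrite natrB ?(ltnW ni) // subKr => H1.
apply: (le_trans (ler_wpM2l (ler0n R n) (ler_normD _ _))).
rewrite mulrDr [`|n%:R ^+ l - _|]ger0_norm; last by apply: powB_ge0; rewrite -?natrB ?(ltnW ni) ?ler0n.
apply: (le_trans (lerD (IHi (ltnW ni)) H1)).
rewrite -mulrDl; apply: ler_wpM2r; first by rewrite exprn_ge0.
rewrite -mulrDr; apply: ler_wpM2l => //.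
by rewrite -natr1; have := ler0n R i; move: (i%:R : R) => y; nra.
Qed.

Lemma power_sum_expansion l n i : (i <= n)%N ->
  n%:R * `|power_sum l.+1 (n - i) - (n%:R ^+ l.+2 / l.+2%:R + n%:R ^+ l.+1 / 2 - i%:R * n%:R ^+ l.+1)|
  <= l.+1%:R ^+ 3 * (1 + i%:R ^+ 2) * n%:R ^+ l.+1.
Proof.
move=> ni; have H1 := power_sum_bound l n; have H2 := power_sum_sub l.+1 ni.
set x := power_sum _ n in H1 H2; set y := power_sum _ (n - i) in H2 *.
set u := _ / l.+2%:R in H1 *; set v := _ / 2 in H1 *.
have -> : y - (u + v - i%:R * n%:R ^+ l.+1) =
  (y - x + i%:R * n%:R ^+ l.+1) + (x - u - v) by ring.
apply: (le_trans (ler_wpM2l (ler0n R n) (ler_normD _ _))); rewrite mulrDr.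
apply: (le_trans (lerD H2 H1)); rewrite -mulrDl; apply: ler_wpM2r; first by rewrite exprn_ge0.
rewrite addrC mulrDr mulr1 lerD2l; apply: ler_wpM2r; first by rewrite exprn_ge0.
by rewrite -natrX ler_nat -[leqLHS]expn1 leq_pexp2l.
Qed.

End PowerSums.

(** * Geometric tail of the last occupied block *)

Section Tail.
Variable R : realType.

Lemma geometric_sqr_bound (r : R) : 0 <= r -> r < 1 ->
  exists2 K, 0 <= K & forall N, \sum_(i < N) (1 + i%:R ^+ 2) * r ^+ i <= K.
Proof.
move=> r0 r1; set a := (1 - r)^-1; have a0 : 0 < a by rewrite invr_gt0; lra.
have ar : a * (1 - r) = 1 by rewrite mulVf // gt_eqF //; lra.
set b := 2 * a ^+ 2; set c := (a + b + 1) * a.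
have b0 : 0 < b by rewrite mulr_gt0 // exprn_gt0.
have c0 : 0 < c by rewrite mulr_gt0 //; lra.
(* The coefficients make [P N - r P (N + 1)] dominate [1 + N^2], so that the partial sums telescope
   below [P 0]. *)
pose P N : R := a * N%:R ^+ 2 + b * N%:R + c.
have P0 N : 0 <= P N.
  have := ler0n R N; rewrite /P; move: (N%:R : R) => y y0.
  by apply: addr_ge0; [apply: addr_ge0|exact: ltW]; apply: mulr_ge0; rewrite ?exprn_ge0 ?(ltW a0) ?(ltW b0).
have step N : (1 + N%:R ^+ 2) <= P N - r * P N.+1.
  rewrite /P -natr1; have := ler0n R N; move: (N%:R : R) => y y0.
  have E1 : b * (1 - r) = 2 * a by rewrite /b expr2 -!mulrA ar mulr1.
  have E2 : c * (1 - r) = a + b + 1 by rewrite /c -mulrA ar mulr1.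
  have -> : a * y ^+ 2 + b * y + c - r * (a * (y + 1) ^+ 2 + b * (y + 1) + c) =
     a * (1 - r) * y ^+ 2 + (b * (1 - r) - 2 * r * a) * y + (c * (1 - r) - r * (a + b)) by ring.
  rewrite ar E1 E2.
  have ar1 : 0 <= (1 - r) * a by rewrite mulr_ge0 ?ltW //; lra.
  have br1 : 0 <= (1 - r) * b by rewrite mulr_ge0 ?ltW //; lra.
  have := mulr_ge0 ar1 y0; nra.
exists (P 0%N) => // N.
suff : \sum_(i < N) (1 + i%:R ^+ 2) * r ^+ i <= P 0%N - r ^+ N * P N.
  by move=> /le_trans; apply; rewrite lerBlDr lerDl mulr_ge0 // exprn_ge0.
elim: N => [|N IHN]; first by rewrite big_ord0 expr0 mul1r subrr.
rewrite big_ord_recr /=; apply: (le_trans (lerD IHN (ler_wpM2r _ (step N)))).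
  by rewrite exprn_ge0.
by rewrite exprS; lra.
Qed.

Lemma pf_le m N : pf R m N <= N%:R ^+ m.
Proof. by rewrite /pf lerBlDr lerDl mulr_ge0 // exprn_ge0. Qed.

Lemma pf_spots m n : n.+1%:R * pf R m n.+1 = n.+1%:R ^+ m * (n.+1%:R - m%:R).
Proof.
case: m => [|m]; first by rewrite pf0 expr0 mul1r mulr1 subr0.
by rewrite /pf /= exprS; ring.
Qed.

(* Chernoff's bound: [C(M, i) (i + 1)^i (n - i)^(M - i)] is [c ^ i] times a term
   of the expansion of [((i + 1) / c + n - i) ^ M]. *)
Lemma block_tail (c : R) n M i : 0 < c -> c < 1 -> M%:R <= c * n.+1%:R -> (i <= M <= n)%N ->
  block R 1 M n i <= expR (1 - c) * (c * expR (1 - c)) ^+ i * n.+1%:R ^+ M.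
Proof.
move=> c0 c1 Mc /andP[iM Mn].
have N0 : 0 < n.+1%:R :> R by rewrite ltr0n.
set x : R := (n - i)%:R; set y : R := c^-1 * i.+1%:R.
have x0 : 0 <= x by [].
have y0 : 0 <= y by rewrite mulr_ge0 // invr_ge0 ltW.
have ci0 : 0 <= c ^+ i by rewrite exprn_ge0 // ltW.
have H1 : block R 1 M n i <= c ^+ i * (x ^+ (M - i) * y ^+ i *+ 'C(M, i)).
  have -> : c ^+ i * (x ^+ (M - i) * y ^+ i *+ 'C(M, i)) =
      i.+1%:R ^+ i * x ^+ (M - i) *+ 'C(M, i).
    rewrite mulrnAr; congr (_ *+ _); rewrite mulrCA -exprMn /y mulrA divff ?gt_eqF //.
    by rewrite mul1r mulrC.
  rewrite /block addn1; apply: ler_wMn2r.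
  by apply: ler_pM; rewrite ?pf_le ?pf_ge0 // leq_sub2r.
have H2 : x ^+ (M - i) * y ^+ i *+ 'C(M, i) <= (x + y) ^+ M.
  have iM' : (i < M.+1)%N by [].
  rewrite exprDn (bigD1 (Ordinal iM')) //= lerDl; apply: sumr_ge0 => k _.
  by rewrite mulrn_wge0 // mulr_ge0 // exprn_ge0.
have H3 : x + y <= n.+1%:R * expR ((c^-1 - 1) * (i.+1%:R / n.+1%:R)).
  apply: (le_trans (y := n.+1%:R * (1 + (c^-1 - 1) * (i.+1%:R / n.+1%:R)))).
    have -> : x = n.+1%:R - i.+1%:R by rewrite -natrB ?subSS // ltnS (leq_trans iM Mn).
    rewrite le_eqVlt; apply/orP; left; apply/eqP; rewrite /y.
    by move: (n.+1%:R : R) N0 (i.+1%:R : R) c0 => N N0 I c0; field; rewrite !gt_eqF.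
  by rewrite ler_pM2l // expR_ge1Dx.
(* Here [M / (n + 1) <= c] reduces the exponent to [c (1/c - 1)(i + 1) = (1 - c)(i + 1)]. *)
have H4 : (x + y) ^+ M <= n.+1%:R ^+ M * expR ((1 - c) * i.+1%:R).
  apply: (le_trans (lerXn2r M _ _ H3)).
  - by rewrite nnegrE addr_ge0.
  - by rewrite nnegrE mulr_ge0 ?expR_ge0.
  rewrite exprMn -expRM_natl; apply: ler_wpM2l; first by rewrite exprn_ge0.
  rewrite ler_expR.
  have -> : M%:R * ((c^-1 - 1) * (i.+1%:R / n.+1%:R)) = M%:R / n.+1%:R * ((c^-1 - 1) * i.+1%:R).
    by ring.
  have cc : 0 <= c^-1 - 1 by rewrite subr_ge0 invf_ge1 // ltW.
  apply: (le_trans (y := c * ((c^-1 - 1) * i.+1%:R))).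
    by apply: ler_wpM2r; [rewrite mulr_ge0 | rewrite ler_pdivrMr].
  by rewrite mulrA mulrBr divff ?gt_eqF // mulr1.
apply: (le_trans H1); apply: (le_trans (ler_wpM2l ci0 (le_trans H2 H4))).
have -> : (1 - c) * i.+1%:R = (1 - c) + i%:R * (1 - c) by rewrite -natr1; ring.
rewrite expRD expRM_natl exprMn.
by rewrite le_eqVlt; apply/orP; left; apply/eqP; ring.
Qed.

(** That is, [E (1 + L^2)] is bounded uniformly in [n]. The ratio [c exp(1 - c)] of [block_tail] is
    below 1 since [exp(c - 1) > c], and the total weight is at least [(1 - c)(n + 1)^M]. *)
Lemma second_moment_bound (c : R) : 0 < c -> c < 1 -> exists2 K, 0 <= K &
  forall n M, (M < n)%N -> M%:R <= c * n.+1%:R ->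
  \sum_(i < M.+1) block R 1 M n i * (1 + i%:R ^+ 2) <= K * pf R M n.+1.
Proof.
move=> c0 c1; set r := c * expR (1 - c).
have r0 : 0 <= r by rewrite mulr_ge0 ?expR_ge0 // ltW.
have r1 : r < 1.
  rewrite /r -[1 - c]opprB expRN ltr_pdivrMr ?expR_gt0 // mul1r.
  have := @expR_gt1Dx R (c - 1); rewrite addrCA subrr addr0; apply.
  by rewrite subr_eq0 lt_eqF.
have [K K0 HK] := geometric_sqr_bound r0 r1.
exists (expR (1 - c) * K / (1 - c)).
  by rewrite divr_ge0 ?mulr_ge0 ?expR_ge0 // subr_ge0 ltW.
move=> n M Mn Mc; have N0 : 0 < n.+1%:R :> R by rewrite ltr0n.
have G : (1 - c) * n.+1%:R ^+ M <= pf R M n.+1.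
  rewrite -(ler_pM2l N0) pf_spots [_ * n.+1%:R ^+ M]mulrC mulrCA; apply: ler_wpM2l; first by rewrite exprn_ge0.
  by rewrite mulrBr; lra.
apply: (le_trans (y := \sum_(i < M.+1) (expR (1 - c) * n.+1%:R ^+ M) * ((1 + i%:R ^+ 2) * r ^+ i))).
  apply: ler_sum => i _; have iM : (i <= M)%N by rewrite -ltnS.
  apply: (le_trans (ler_wpM2r _ (block_tail c0 c1 Mc _))).
  - by rewrite addr_ge0 // exprn_ge0.
  - by rewrite iM ltnW.
  by rewrite le_eqVlt -/r; apply/orP; left; apply/eqP; ring.
rewrite -mulr_sumr.
have e0 : 0 <= expR (1 - c) * n.+1%:R ^+ M by rewrite mulr_ge0 ?expR_ge0 ?exprn_ge0.
apply: (le_trans (ler_wpM2l e0 (HK _))).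
have -> : expR (1 - c) * n.+1%:R ^+ M * K = expR (1 - c) * K / (1 - c) * ((1 - c) * n.+1%:R ^+ M).
  by field; rewrite subr_eq0 gt_eqF.
apply: ler_wpM2l G.
by rewrite divr_ge0 ?mulr_ge0 ?expR_ge0 // subr_ge0 ltW.
Qed.

End Tail.

(** * Asymptotics *)

Local Open Scope classical_set_scope.
Local Open Scope ring_scope.

Lemma eqO_nat (R : realType) (e g : nat -> R) (C : R) :
  (forall n, (0 < n)%N -> `|e n| <= C * `|g n|) -> e =O_\oo g.
Proof.
move=> H; apply/eqO_exP; exists (`|C| + 1); first by rewrite ltr_wpDl.
exists 1%N => // n /= n1; apply: (le_trans (H n n1)).
by rewrite ler_wpM2r // (le_trans (ler_norm C)) // lerDl.
Qed.

(** * Expansions for m = n *)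

Section FullStreetAsymptotics.
Variable R : realType.

Lemma inv_sqrt_nat n : (0 < n)%N -> exists w : R,
  [/\ (Num.sqrt n%:R)^-1 = w, 0 < w <= 1, n%:R^-1 = w ^+ 2 & Num.sqrt n%:R * w = 1].
Proof.
move=> n0; exists (Num.sqrt n%:R)^-1.
have s1 : 1 <= Num.sqrt n%:R :> R by rewrite -{1}[1]sqrtr1 ler_wsqrtr // ler1n.
have s0 := lt_le_trans ltr01 s1.
split=> //; first by rewrite invr_gt0 s0 invf_le1.
  by rewrite exprVn sqr_sqrtr.
by rewrite divff // gt_eqF.
Qed.

Lemma sqrt_succ_le n : (0 < n)%N -> Num.sqrt n.+1%:R <= 2 * Num.sqrt n%:R :> R.
Proof.
move=> n0; rewrite -[leLHS]ger0_norm ?sqrtr_ge0 // -[leRHS]ger0_norm ?mulr_ge0 ?sqrtr_ge0 //.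
rewrite -ler_sqr ?nnegrE ?normr_ge0 // !real_normK ?num_real // exprMn !sqr_sqrtr //.
rewrite -natrX -natrM ler_nat; lia.
Qed.

Lemma full_street_mean : exists e : nat -> R,
  e =O_\oo (fun n : nat => (Num.sqrt n%:R)^-1 : R) /\
  forall n : nat, (0 < n)%N ->
    moment1 R n n 1 =
    n%:R / 2 * (1 - Num.sqrt (pi / (2 * n%:R)) + 10 / (3 * n%:R) + e n).
Proof.
exists (fun n => moment1 R n n 1 * (2 / n%:R) -
  (1 - Num.sqrt (pi / (2 * n%:R)) + 10 / (3 * n%:R))); split; last first.
  move=> n n0; have nz : n%:R != 0 :> R by rewrite pnatr_eq0 -lt0n.
  by move: (Num.sqrt _) (moment1 _ _ _ _) => a b; field.
(* With [w = n^(-1/2)], the terms [2 / n], [tau / n] and [10 / (3 n)] are at most [2 w], [4 w] and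
   [10/3 w]; 16 leaves room. *)
apply: (@eqO_nat _ _ _ (16 + Num.sqrt (pi / 2))) => -[//|M] _.
rewrite moment1_full_1; have := tau_ge0 R M; have := tau_le R M.
have := @sqrt_succ_le M.+1 isT.
have -> : Num.sqrt (pi / (2 * M.+1%:R)) = Num.sqrt (pi / 2) * (Num.sqrt M.+1%:R)^-1 :> R.
  by rewrite invfM mulrA sqrtrM ?divr_ge0 ?pi_ge0 // sqrtrV.
have [w [-> /andP[w0 w1] nw sw]] := @inv_sqrt_nat M.+1 isT.
rewrite (invfM 3) nw (mulrA 10).
have nn : M.+1%:R * w ^+ 2 = 1 by rewrite -nw divff.
rewrite (gtr0_norm w0).
have := sqrtr_ge0 (pi / 2 : R).
move: (M.+1%:R : R) (Num.sqrt (pi / 2 : R)) (abel2 _ _ _ / _) (Num.sqrt (M.+2%:R : R)) (Num.sqrt (M.+1%:R : R)) sw nn.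
move=> n q t s1 s sw nn q0 s12 ts t0.
have tw : t * w ^+ 2 <= 4 * w.
  rewrite expr2 mulrA ler_wpM2r ?(ltW w0) //.
  have : 0 <= (4 * s - t) * w by rewrite mulr_ge0 ?(ltW w0) //; lra.
  by lra.
have tw0 : 0 <= t * w ^+ 2 by rewrite mulr_ge0 // ltW // exprn_gt0.
have qw : 0 <= q * w by rewrite mulr_ge0 // ltW.
have ww : 0 <= w ^+ 2 <= w by nra.
have -> : (n + 2 - t) / 2 * (2 * w ^+ 2) - (1 - q * w + 10 / 3 * w ^+ 2) =
  2 * w ^+ 2 - t * w ^+ 2 + q * w - 10 / 3 * w ^+ 2.
  by lra.
by rewrite ler_norml mulrDl; apply/andP; split; lra.
Qed.

Lemma full_street_second_moment : exists e : nat -> R,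
  e =O_\oo (fun n : nat => (Num.sqrt n%:R)^-1 : R) /\
  forall n : nat, (0 < n)%N ->
    moment1 R n n 2 =
    n%:R ^+ 2 / 3 *
    (1 - 3 * Num.sqrt (2 * pi) / (4 * Num.sqrt n%:R) + 11 / (2 * n%:R) + e n).
Proof.
exists (fun n => moment1 R n n 2 * (3 / n%:R ^+ 2) -
  (1 - 3 * Num.sqrt (2 * pi) / (4 * Num.sqrt n%:R) + 11 / (2 * n%:R))); split; last first.
  move=> n n0; have nz : n%:R != 0 :> R by rewrite pnatr_eq0 -lt0n.
  have sz : Num.sqrt n%:R != 0 :> R by rewrite gt_eqF // sqrtr_gt0 ltr0n.
  by move: (Num.sqrt n%:R) sz (Num.sqrt _) (moment1 _ _ _ _) => s sz a b; field; rewrite nz sz.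
(* Here [2 tau / n <= 8 w] and [11 / (2 n) <= 11/2 w], again within [16 w]. *)
apply: (@eqO_nat _ _ _ (16 + Num.sqrt (2 * pi))) => -[//|M] _.
have := moment1_full_2 R M; have := tau_ge0 R M; have := tau_le R M.
have := @sqrt_succ_le M.+1 isT.
have [w [ws /andP[w0 w1] nw sw]] := @inv_sqrt_nat M.+1 isT.
rewrite (invfM 4) (invfM 2) -exprVn nw ws (gtr0_norm w0).
have nn : M.+1%:R * w ^+ 2 = 1 by rewrite -nw divff.
have := sqrtr_ge0 (2 * pi : R).
move: (M.+1%:R : R) (Num.sqrt (2 * pi : R)) (abel2 _ _ _ / _) (Num.sqrt (M.+2%:R : R)) (Num.sqrt (M.+1%:R : R)) (moment1 _ _ _ _) sw nn.
move=> n q t s1 s mo sw nn q0 s12 ts t0 Hmo.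
have tw : t * w ^+ 2 <= 4 * w.
  rewrite expr2 mulrA ler_wpM2r ?(ltW w0) //.
  have : 0 <= (4 * s - t) * w by rewrite mulr_ge0 ?(ltW w0) //; lra.
  by lra.
have tw0 : 0 <= t * w ^+ 2 by rewrite mulr_ge0 // ltW // exprn_gt0.
have qw : 0 <= q * w by rewrite mulr_ge0 // ltW.
have ww : 0 <= w ^+ 2 <= w by nra.
have moE : `|mo * (3 * (w ^+ 2) ^+ 2) - 1| <= 2 * (t * w ^+ 2).
  have -> : mo * (3 * (w ^+ 2) ^+ 2) - 1 = 3 * (w ^+ 2) ^+ 2 * (mo - n ^+ 2 / 3).
    have nn2 : n ^+ 2 * (w ^+ 2) ^+ 2 = 1 by rewrite -exprMn nn expr1n.
    by lra.
  have c0 : 0 <= 3 * (w ^+ 2) ^+ 2 by rewrite mulr_ge0 // exprn_ge0 // exprn_ge0 // ltW.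
  rewrite normrM (ger0_norm c0); apply: (le_trans (ler_wpM2l c0 Hmo)).
  rewrite le_eqVlt; apply/orP; left; apply/eqP.
  have nn2 : n * (w ^+ 2) ^+ 2 = w ^+ 2 by rewrite [(w ^+ 2) ^+ 2]expr2 mulrA nn mul1r.
  by have : n * (w ^+ 2) ^+ 2 * t = w ^+ 2 * t; [rewrite nn2 | lra].
move: moE; rewrite !ler_norml => /andP[m1 m2].
by apply/andP; split; lra.
Qed.

End FullStreetAsymptotics.

(** The real arithmetic of (i): [X] stands for the scaled mean of the power sum, [alpha] for
    [E (n - L)], hence [mu = n - alpha] for [E L], which tends to [c / (1 - c)]. *)
Lemma normalized_moment_error (R : realFieldType) (c l K : R) : 0 < c -> c < 1 -> 0 <= l -> 0 <= K ->
  exists C, forall n alpha X : R, 1 <= n -> 1 <= c * n ->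
  alpha = (n + 1) * ((1 - c) * n + 1) / ((1 - c) * n + 2) ->
  n * `|X - (n / (l + 1) + 1 / 2 - (n - alpha))| <= K ->
  `|X / alpha * (l + 1) - (1 + (1 - c + l * (1 - 3 * c)) / (2 * (1 - c)) * n^-1)| <= C * n ^- 2.
Proof.
move=> c0 c1 l0 K0; set kappa := _ / (2 * (1 - c)); set q := 1 - c.
have q0 : 0 < q by rewrite subr_gt0.
(* The three summands bound [l n |mu - c / q|], [(l + 1) n |Y|] and [mu |kappa|]; the factor 2 comes
   from [alpha >= n / 2]. *)
exists (2 * (l * (2 / q ^+ 2) + (l + 1) * K + `|kappa| / q)) => n alpha X n1 cn1 alphaE HX.
have n0 : 0 < n by lra.
have qn0 : 0 < q * n by rewrite mulr_gt0.
have qn2 : q * n + 2 != 0 by rewrite gt_eqF //; lra.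
set mu := n - alpha in HX.
have muE : mu = (c * n - 1) / (q * n + 2) by rewrite /mu alphaE /q; field.
have mu0 : 0 <= mu by rewrite muE divr_ge0 //; lra.
have muq : mu <= q^-1.
  rewrite muE ler_pdivrMr; last by lra.
  rewrite mulrDr mulKf ?gt_eqF //.
  have : 0 <= q^-1 by rewrite invr_ge0 ltW.
  have : c * n <= n by rewrite ler_piMl // ltW.
  lra.
have muc : n * `|mu - c / q| <= 2 / q ^+ 2.
  have -> : mu - c / q = - ((1 + c) / (q * (q * n + 2))).
    by rewrite muE /q; field; rewrite -/q qn2 gt_eqF.
  rewrite normrN ger0_norm; last by rewrite divr_ge0 ?mulr_ge0 //; lra.
  rewrite mulrA ler_pdivrMr; last by rewrite mulr_gt0 //; lra.
  have -> : 2 / q ^+ 2 * (q * (q * n + 2)) = 2 * n + 4 / q by field; rewrite gt_eqF.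
  have : 0 <= 4 / q by rewrite divr_ge0 // ltW.
  have : c * n <= n by rewrite ler_piMl // ltW.
  lra.
have alpha2 : n / 2 <= alpha.
  rewrite alphaE ler_pdivlMr; last by lra.
  by rewrite -/q; nra.
have alpha0 : 0 < alpha by lra.
set Y := X - _ in HX.
have -> : X / alpha * (l + 1) - (1 + kappa * n^-1) =
  (- (l * (n * (mu - c / q))) + (l + 1) * (n * Y) + mu * kappa) / (alpha * n).
  have XE : X = Y + (n / (l + 1) + 1 / 2 - mu) by rewrite /Y subrK.
  (* This form shows the origin of the coefficient: the trapezoidal half term and the limit [c / q]
     of [mu]. *)
  have kE : kappa = (l + 1) / 2 - l * (c / q) by rewrite /kappa /q; field; rewrite subr_eq0 gt_eqF.
  have aE : alpha = n - mu by rewrite /mu subKr.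
  rewrite XE kE aE; field.
  by rewrite -aE !gt_eqF //; lra.
have an0 : 0 < alpha * n by rewrite mulr_gt0.
rewrite normrM normfV (gtr0_norm an0) ler_pdivrMr //.
set B := _ + _ + _ / q.
have B0 : 0 <= B.
  have l1 : 0 <= l + 1 by lra.
  by rewrite /B !addr_ge0 // ?divr_ge0 ?(ltW q0) // mulr_ge0 // divr_ge0 // exprn_ge0 // ltW.
apply: (le_trans (y := B)).
  apply: (le_trans (ler_normD _ _)); apply: lerD; last first.
    by rewrite normrM (ger0_norm mu0) [leRHS]mulrC ler_wpM2r.
  apply: (le_trans (ler_normD _ _)); apply: lerD.
    by rewrite normrN !normrM (ger0_norm l0) (gtr0_norm n0) ler_wpM2l.
  rewrite !normrM (gtr0_norm n0) (ger0_norm (_ : 0 <= l + 1)); last by lra.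
  by rewrite ler_wpM2l //; lra.
have -> : 2 * B * n ^- 2 * (alpha * n) = B * (2 * alpha / n) by field; rewrite gt_eqF.
by rewrite ler_peMr // ler_pdivlMr //; lra.
Qed.

(** * Expansion for m = c n *)

Section FixedDensity.
Variable R : realType.

(** [power_sum_expansion] is averaged over the law of [L]: [E L = n - A / G] is explicit by
    [pf_spots], and [second_moment_bound] controls the remainder. *)
Lemma moment1_density (c : R) l : 0 < c -> c < 1 -> exists C : R,
  forall M n : nat, M.+1%:R = c * n%:R ->
  `|moment1 R M.+1 n l.+1 * (l.+2%:R / n%:R ^+ l.+1) -
    (1 + (1 - c + l.+1%:R * (1 - 3 * c)) / (2 * (1 - c)) * n%:R^-1)| <= C * n%:R ^- 2.
Proof.
move=> c0 c1; have [K2 K20 HK2] := second_moment_bound c0 c1.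
have K0 : 0 <= l.+1%:R ^+ 3 * K2 by rewrite mulr_ge0 // exprn_ge0.
have [C HC] := normalized_moment_error c0 c1 (ler0n R l.+1) K0.
exists C => M n mE.
have n0 : (0 < n)%N by rewrite lt0n; apply/eqP => n0; move: mE; rewrite n0 mulr0 => /eqP; rewrite pnatr_eq0.
have N0 : 0 < n%:R :> R by rewrite ltr0n.
have mn : (M.+1 < n)%N by rewrite -(ltr_nat R) mE gtr_pMl.
have Mn := ltnW mn.
have Mc : M%:R <= c * n.+1%:R by rewrite -natr1 mulrDr mulr1 -mE -natr1; lra.
set G := pf R M n.+1; set A := pf R M.+1 n.+1.
have N1 : 0 < n.+1%:R :> R by rewrite ltr0n.
have mM : M%:R = c * n%:R - 1 by rewrite -mE -natr1 addrK.
have GE : n.+1%:R * G = n.+1%:R ^+ M * ((1 - c) * n%:R + 2).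
  by rewrite /G pf_spots mM -natr1; congr (_ * _); ring.
have AE : A = n.+1%:R ^+ M * ((1 - c) * n%:R + 1).
  apply: (mulfI (lt0r_neq0 N1)); rewrite /A pf_spots mE mulrA -exprS -natr1.
  by congr (_ * _); ring.
have P0 : 0 < n.+1%:R ^+ M :> R by rewrite exprn_gt0.
have q0 : 0 < (1 - c) * n%:R by rewrite mulr_gt0 // subr_gt0.
have G0 : 0 < G by rewrite -(pmulr_rgt0 _ N1) GE mulr_gt0 //; lra.
have A0 : 0 < A by rewrite AE mulr_gt0 //; lra.
have AG : A / G = (n%:R + 1) * ((1 - c) * n%:R + 1) / ((1 - c) * n%:R + 2).
  have GE' : G = n.+1%:R ^+ M * ((1 - c) * n%:R + 2) / n.+1%:R by rewrite -GE mulrC mulKf ?gt_eqF.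
  rewrite AE GE'; move: (n.+1%:R ^+ M) P0 N1 => P P0; rewrite -natr1 => N1; field.
  by rewrite !gt_eqF //; lra.
have {}P0 : 0 < n%:R ^+ l.+1 :> R by rewrite exprn_gt0.
set S := \sum_(i < M.+1) block R 1 M n i * power_sum R l.+1 (n - i).
have momE : moment1 R M.+1 n l.+1 = S / A by rewrite moment1E.
have GS : \sum_(i < M.+1) block R 1 M n i = G by rewrite sum_block ?addn1 // ltnW.
have AS : \sum_(i < M.+1) block R 1 M n i * (n - i)%:R = A by rewrite -pf_mean.
(* Dividing by [G] normalises the weights, so the moment is the quotient of the mean of the power
   sum by the mean [A / G] of [n - L]. *)
pose X := S / (n%:R ^+ l.+1 * G).
have -> : moment1 R M.+1 n l.+1 * (l.+2%:R / n%:R ^+ l.+1) = X / (A / G) * (l.+1%:R + 1).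
  by rewrite momE /X natr1; field; rewrite !gt_eqF.
apply: HC; rewrite ?ler1n // -?mE ?ler1n //.
have -> : X - (n%:R / (l.+1%:R + 1) + 1 / 2 - (n%:R - A / G)) =
    (\sum_(i < M.+1) block R 1 M n i * (power_sum R l.+1 (n - i) -
      (n%:R ^+ l.+2 / l.+2%:R + n%:R ^+ l.+1 / 2 - i%:R * n%:R ^+ l.+1))) / (n%:R ^+ l.+1 * G).
  (* Writing [i = n - (n - i)] expresses the linear term through [G] and [A]. *)
  have -> : \sum_(i < M.+1) block R 1 M n i * (power_sum R l.+1 (n - i) -
      (n%:R ^+ l.+2 / l.+2%:R + n%:R ^+ l.+1 / 2 - i%:R * n%:R ^+ l.+1)) =
    S - (n%:R ^+ l.+2 / l.+2%:R + n%:R ^+ l.+1 / 2 - n%:R * n%:R ^+ l.+1) * G - n%:R ^+ l.+1 * A.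
    rewrite -GS -AS !mulr_sumr -!sumrB; apply: eq_bigr => i _.
    rewrite natrB; last by rewrite (leq_trans (ltnW (ltn_ord i))).
    by ring.
  have l2 : l.+2%:R != 0 :> R by rewrite pnatr_eq0.
  rewrite natr1 /X [n%:R ^+ l.+2]exprS; field.
  by rewrite -natrD pnatr_eq0 /= !gt_eqF.
have d0 : 0 < n%:R ^+ l.+1 * G by rewrite mulr_gt0.
rewrite normrM normfV (gtr0_norm d0) mulrA ler_pdivrMr //.
apply: (le_trans (ler_wpM2l (ltW N0) (ler_norm_sum _ _ _))); rewrite mulr_sumr.
have -> : l.+1%:R ^+ 3 * K2 * (n%:R ^+ l.+1 * G) = l.+1%:R ^+ 3 * n%:R ^+ l.+1 * (K2 * G) by ring.
apply: (le_trans _ (ler_wpM2l _ (HK2 n M Mn Mc))); last by rewrite mulr_ge0 ?exprn_ge0.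
rewrite mulr_sumr; apply: ler_sum => i _.
have iM : (i <= M)%N by rewrite -ltnS.
have b0 : 0 <= block R 1 M n i by rewrite block_ge0 // ltnW.
rewrite normrM (ger0_norm b0) mulrCA.
apply: (le_trans (ler_wpM2l b0 (power_sum_expansion R l _))); first by rewrite (leq_trans iM) // ltnW.
by rewrite le_eqVlt; apply/orP; left; apply/eqP; ring.
Qed.

End FixedDensity.

Theorem theorem3p13 (R : realType) :
  (forall (c : R) (l : nat), 0 < c -> c < 1 -> (0 < l)%N ->
     exists e : nat -> R,
       e =O_\oo (fun n : nat => n%:R ^- 2 : R) /\
       forall m n : nat, (0 < n)%N -> m%:R = c * n%:R ->
         moment1 R m n l =
           n%:R ^+ l / l.+1%:R *
           (1 + (1 - c + l%:R * (1 - 3 * c)) / (2 * (1 - c)) * n%:R^-1 + e n))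
  /\
  (exists e : nat -> R,
     e =O_\oo (fun n : nat => (Num.sqrt n%:R)^-1 : R) /\
     forall n : nat, (0 < n)%N ->
       moment1 R n n 1 =
         n%:R / 2 *
         (1 - Num.sqrt (pi / (2 * n%:R)) + 10 / (3 * n%:R) + e n))
  /\
  (exists e : nat -> R,
     e =O_\oo (fun n : nat => (Num.sqrt n%:R)^-1 : R) /\
     forall n : nat, (0 < n)%N ->
       moment1 R n n 2 =
         n%:R ^+ 2 / 3 *
         (1 - 3 * Num.sqrt (2 * pi) / (4 * Num.sqrt n%:R)
            + 11 / (2 * n%:R) + e n)).
Proof.
split; last by split; [exact: full_street_mean | exact: full_street_second_moment].
move=> c [//|l] c0 c1 _; have [C HC] := moment1_density l c0 c1.
pose kappa : R := (1 - c + l.+1%:R * (1 - 3 * c)) / (2 * (1 - c)).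
(* [n] determines [m], whence an error term depending on [n] only. *)
exists (fun n => let m := Num.truncn (c * n%:R) in
  if (0 < n)%N && (m%:R == c * n%:R) then
    moment1 R m n l.+1 * (l.+2%:R / n%:R ^+ l.+1) - (1 + kappa * n%:R^-1)
  else 0); split.
  apply: (@eqO_nat _ _ _ `|C|) => n n0; rewrite n0 /=.
  rewrite -normrM; case: eqP => [|_]; last by rewrite normr0.
  case: Num.truncn => [|M] mE; last exact: le_trans (HC M n mE) (ler_norm _).
  by move/eqP: mE; rewrite eq_sym mulf_eq0 gt_eqF //= pnatr_eq0 gtn_eqF.
move=> m n n0 mE; rewrite n0 -mE natrK /= eqxx.
have nl : n%:R ^+ l.+1 != 0 :> R by rewrite expf_neq0 // pnatr_eq0 -lt0n.
have lz : l.+2%:R != 0 :> R by rewrite pnatr_eq0.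
by rewrite -/kappa [X in _ * X]addrC subrK mulrCA -(invf_div (n%:R ^+ _)) divff ?mulr1 // mulf_neq0 ?invr_eq0.
Qed.
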